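(* Let $\Bbbk$ be a field of characteristic $0$ and let $t,m,n$ be integers with $m\le n$, $1<t<m$ and $n>t+1$. Then the ideal $J_t(m,n)$ of relations between the $t$-minors of a generic $m\times n$ matrix has some minimal generators of degree $3$.
   Context: Let $X=(x_{ij})$ be an $m\times n$ matrix of indeterminates over $\Bbbk$, $A_t(m,n)\subseteq\Bbbk[x_{ij}]$ the $\Bbbk$-subalgebra generated by the $t$-minors of $X$, $S_t(m,n)$ the standard graded polynomial ring over $\Bbbk$ whose variables are indexed by the $t$-minors of $X$, $\pi:S_t(m,n)\to A_t(m,n)$ the surjective $\Bbbk$-algebra homomorphism sending each variable to the corresponding minor, and $J_t(m,n)=\ker\pi$ (a homogeneous ideal of $S_t(m,n)$). *)

(* Defs.v *)
From HB Require Import structures.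
From mathcomp Require Import all_boot all_order all_fingroup all_algebra.
From mathcomp Require Import mpoly.

Set Implicit Arguments.
Unset Strict Implicit.
Unset Printing Implicit Defensive.

Import GRing.Theory.

Local Open Scope ring_scope.

(* Ideals of R generated by a possibly infinite family. *)
Definition in_ideal_gen (R : comNzRingType) (G : R -> Prop) (f : R) : Prop :=
  exists s : seq (R * R),
    (forall p, p \in s -> G p.2) /\ f = \sum_(p <- s) p.1 * p.2.

Definition generates (R : comNzRingType) (J : {pred R}) (G : R -> Prop) : Prop :=
  forall f, f \in J <-> in_ideal_gen G f.

Section MinimalGenerators.
Variables (N : nat) (k : fieldType).
Implicit Types (J : {pred {mpoly k[N]}}) (G : {mpoly k[N]} -> Prop).

(* Minimality is with respect to inclusion: no proper subset of G generates. *)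
Definition minimal_homog_generating_set J G : Prop :=
  [/\ forall g, G g -> g \is homog mdeg,
      generates J G
    & forall G' : {mpoly k[N]} -> Prop,
        (forall g, G' g -> G g) -> generates J G' -> forall g, G g -> G' g].

Definition minimal_generator J (f : {mpoly k[N]}) : Prop :=
  exists2 G, minimal_homog_generating_set J G & G f.

End MinimalGenerators.

Section MinorRelations.
Variables (k : fieldType) (t m n : nat).

(* A t-element subset of {0, ..., l-1}, given by its increasing enumeration. *)
Definition increasing (l : nat) (f : {ffun 'I_t -> 'I_l}) : bool :=
  [forall i : 'I_t, forall j : 'I_t, (i < j)%N ==> (f i < f j)%N].

(* The index set of the t-minors: a choice of t rows and of t columns. *)
Definition minor_index : finType :=
  ({f : {ffun 'I_t -> 'I_m} | increasing f} *
   {f : {ffun 'I_t -> 'I_n} | increasing f})%type.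

(* The indeterminates x_ij are the m * n variables of {mpoly k[m * n]}. *)
Definition generic_matrix : 'M[{mpoly k[m * n]}]_(m, n) :=
  \matrix_(i < m, j < n) 'X_(mxvec_index i j).

Definition generic_minor (rc : minor_index) : {mpoly k[m * n]} :=
  \det (mxsub (val rc.1) (val rc.2) generic_matrix).

(* {mpoly k[#|minor_index|]} is S_t(m, n): its i-th variable is the one indexed
   by enum_val i. The map of S_t(m, n) onto A_t(m, n) is given the codomain
   k[x_ij], which does not affect its kernel. *)
Definition minor_map (f : {mpoly k[#|minor_index|]}) : {mpoly k[m * n]} :=
  f \mPo [tuple generic_minor (enum_val i) | i < #|minor_index|].

Definition minor_relations : {pred {mpoly k[#|minor_index|]}} :=
  [pred f | minor_map f == 0].

End MinorRelations.

Arguments minor_map : clear implicits.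
Arguments minor_relations : clear implicits.

(* Main.v *)
Require Import Defs.
From mathcomp Require Import all_boot all_order all_fingroup all_algebra.
From mathcomp Require Import mpoly zify.
From Stdlib Require Import Classical IndefiniteDescription.

(** Let J be the ideal of relations and S_+ the ideal of the variables of the
    ring S of formal minors.  By the graded Nakayama lemma
    ([indecomposable_minimal_generator]) a homogeneous f in J belongs to a
    minimal homogeneous generating set as soon as f is not in S_+ J.  It is
    therefore enough to exhibit a cubic in J that is not in S_+ J.

    The cubic ([cubic_relation]).  Only the rows 0, ..., t and the columns
    0, ..., t + 1 of X matter.  For i, j < 3 let y_ij be the t-minor whose rows
    are 0, ..., t except i and whose columns are j and the t - 1 columns
    3, ..., t + 1, which all the y_ij share.  For a fixed j, let i run for a
    moment over all of 0, ..., t: the vector of the signed minors y_ij is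
    orthogonal to each of the t - 1 common columns, because their scalar product
    is the Laplace expansion of a determinant with a repeated column.  The three
    vectors j = 0, 1, 2 thus lie, over the field of fractions, in a space of
    dimension (t + 1) - (t - 1) = 2, and det (y_ij) = 0 in k[x_ij] ([cubic_relation_in]).

    Indecomposability ([cubic_relation_indecomposable]).  The monomial
    y_00 y_11 y_22 has coefficient 1 in the formal determinant f.  If f were in
    S_+ J, a product of a variable and a relation q would contain this monomial,
    and q would contain some y_dd y_aa with d < a.  No relation does
    ([relation_coeff0]), because the product of the minors y_dd and y_aa
    contains a monomial in the x_ij that occurs in no other product of two
    t-minors.  A term of a minor is a partial permutation matrix, so this means
    that a certain sum of two such matrices splits in only one way.  The
    criterion for that, [cells_split], is that the position of a single cell of
    one summand determines the whole of the other summand. *)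

Set Implicit Arguments.
Unset Strict Implicit.
Unset Printing Implicit Defensive.

Import GRing.Theory.

Local Open Scope ring_scope.

(** * Vector spaces *)

(** The ideal and its product with the irrelevant ideal are only given as
    predicates; finite dimension makes their graded pieces subspaces. *)
Lemma submod_vspace (K : fieldType) (vT : vectType K) (P : vT -> Prop) :
    P 0 -> (forall a u v, P u -> P v -> P (a *: u + v)) ->
  exists U : {vspace vT}, forall v, v \in U <-> P v.
Proof.
move=> P0 PD.
suff grow e (U : {vspace vT}) : (\dim {:vT} - \dim U <= e)%N ->
    (forall v, v \in U -> P v) -> exists U : {vspace vT}, forall v, v \in U <-> P v.
  apply: (grow _ 0%VS (leqnn _)) => v; rewrite memv0 => /eqP->; exact: P0.
elim: e U => [|e IHe] U leU sUP.
  have U_full : U = fullv.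
    by apply/eqP; rewrite eqEdim subvf /= -subn_eq0 -leqn0.
  by exists U => v; split=> [|_]; [exact: sUP | rewrite U_full memvf].
have [[v Pv vU]|noext] := classic (exists2 v, P v & v \notin U); last first.
  exists U => v; split=> [|Pv]; first exact: sUP.
  by apply/negPn/negP=> vU; apply: noext; exists v.
apply: (IHe (U + <[v]>)%VS) => [|x /memv_addP[u uU [y /vlineP[a ->] ->]]]; last first.
  by rewrite addrC; apply: PD => //; exact: sUP.
have ltU : (\dim U < \dim (U + <[v]>))%N.
  rewrite ltnNge; apply: contra vU => ledim.
  have /eqP-> : U == (U + <[v]>)%VS by rewrite eqEdim addvSl.
  by rewrite memvE addvSr.
have := dimvS (subvf (U + <[v]>)%VS).
move: leU ltU; rewrite !leq_subLR => leU ltU _.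
by rewrite (leq_trans leU) // addnS -addSn leq_add2r.
Qed.

(** The vectors of [X] form a basis of [U] modulo [W], which can be made to pass
    through any vector of [U] that is nonzero modulo [W]. *)
Lemma relative_basis (K : fieldType) (vT : vectType K) (W U : {vspace vT}) v :
    (W <= U)%VS -> v \in U ->
  exists X : seq vT, (v \notin W -> v \in X) /\ basis_of U (vbasis W ++ X).
Proof.
move=> sWU vU.
have [V [X0 [vX0 X0V [VW sVU]]]] : exists V : {vspace vT}, exists X0 : seq vT,
    [/\ v \notin W -> v \in X0, basis_of V (vbasis W ++ X0)
      & (W <= V)%VS /\ (V <= U)%VS].
  have [vW|vW] := boolP (v \in W).
    exists W, [::]; split; first by move/negP.
      by rewrite cats0; exact: vbasisP.
    by split; first exact: subvv.
  exists (W + <[v]>)%VS, [:: v]; split=> [_||]; first by rewrite mem_head.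
    rewrite /basis_of span_cat span_seq1 (span_basis (vbasisP W)) eqxx /=.
    rewrite (perm_free (permEl (perm_catC _ _))) /=.
    by rewrite free_cons (span_basis (vbasisP W)) vW (basis_free (vbasisP W)).
  by split; [exact: addvSl | rewrite subv_add sWU -memvE].
exists (X0 ++ vbasis (U :\: V)%VS); split=> [vW|]; first by rewrite mem_cat vX0.
rewrite /basis_of catA span_cat cat_free (span_basis X0V) (basis_free X0V).
rewrite (span_basis (vbasisP _)) (basis_free (vbasisP _)) /=.
apply/andP; split; first by rewrite addvC addv_diff (addv_idPl sVU).
by apply/directv_addP; rewrite capvC capv_diff.
Qed.

(** * Graded Nakayama lemma *)

Section GradedNakayama.
Variables (N : nat) (k : fieldType).
Implicit Types (J : {pred {mpoly k[N]}}) (p q : {mpoly k[N]}).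

Definition homogeneous_ideal J : Prop :=
  [/\ 0 \in J, forall p q, p \in J -> q \in J -> p + q \in J,
      forall a p, p \in J -> a * p \in J
    & forall d p, p \in J -> pihomog mdeg d p \in J].

Definition irrelevant_mul J p : Prop :=
  exists2 q : 'I_N -> {mpoly k[N]},
    forall i, q i \in J & p = \sum_i 'X_i * q i.

Variable J : {pred {mpoly k[N]}}.
Hypothesis idealJ : homogeneous_ideal J.

Lemma irrelevant_mul_sub p : irrelevant_mul J p -> p \in J.
Proof.
case: idealJ => J0 JD JM _ [q qJ ->].
by elim/big_ind: _ => // i _; apply: JM.
Qed.

Lemma irrelevant_mul0 : irrelevant_mul J 0.
Proof.
case: idealJ => J0 _ _ _; exists (fun=> 0) => //.
by rewrite big1 // => i _; rewrite mulr0.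
Qed.

Lemma irrelevant_mulD p q :
  irrelevant_mul J p -> irrelevant_mul J q -> irrelevant_mul J (p + q).
Proof.
case: idealJ => _ JD _ _ [p' p'J ->] [q' q'J ->].
exists (fun i => p' i + q' i) => [i|]; first exact: JD.
by rewrite -big_split; apply: eq_bigr => i _; rewrite mulrDr.
Qed.

Lemma irrelevant_mulM a p : irrelevant_mul J p -> irrelevant_mul J (a * p).
Proof.
case: idealJ => _ _ JM _ [q qJ ->]; exists (fun i => a * q i) => [i|].
  exact: JM.
by rewrite mulr_sumr; apply: eq_bigr => i _; rewrite mulrCA.
Qed.

Lemma irrelevant_mulZ c p : irrelevant_mul J p -> irrelevant_mul J (c *: p).
Proof. by rewrite -mul_mpolyC; exact: irrelevant_mulM. Qed.

Lemma irrelevant_mulX i p : p \in J -> irrelevant_mul J ('X_i * p).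
Proof.
case: idealJ => J0 _ _ _ pJ; exists (fun j => if j == i then p else 0).
  by move=> j; case: eqP.
rewrite (bigD1 i) //= eqxx big1 ?addr0 // => j /negPf->; exact: mulr0.
Qed.

Lemma pihomogXM d i p :
  pihomog mdeg d.+1 ('X_i * p) = 'X_i * pihomog mdeg d p.
Proof.
elim/mpolyind: p => [|c m p _ _ IHp]; first by rewrite !(mulr0, pihomog0).
rewrite mulrDr !pihomogD mulrDr IHp -scalerAr -mpolyXD !linearZ /= !pihomogX.
rewrite /= (mdegD U_(i) m) mdeg1 eqSS; case: eqP => _; last by rewrite !(mulr0, scaler0).
by rewrite mpolyXD scalerAr.
Qed.

Lemma pihomog0XM i p : pihomog mdeg 0 ('X_i * p) = 0.
Proof.
elim/mpolyind: p => [|c m p _ _ IHp]; first by rewrite !(mulr0, pihomog0).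
rewrite mulrDr pihomogD IHp -scalerAr -mpolyXD linearZ /= pihomogX.
by rewrite /= (mdegD U_(i) m) mdeg1 scaler0 addr0.
Qed.

Lemma irrelevant_mul_pihomog d p :
  irrelevant_mul J p -> irrelevant_mul J (pihomog mdeg d p).
Proof.
case: idealJ => J0 _ _ JH [q qJ ->]; rewrite linear_sum /=.
case: d => [|d]; last first.
  exists (fun i => pihomog mdeg d (q i)) => [i|]; first exact: JH.
  by apply: eq_bigr => i _; exact: pihomogXM.
by rewrite big1 => [|i _]; [exact: irrelevant_mul0 | exact: pihomog0XM].
Qed.

(** The coefficients of a combination of elements of [J] matter modulo [S_+ J]
    only through their constant terms: this turns generation as an ideal into
    linear spanning. *)
Lemma mul_mod_irrelevant a p :
  p \in J -> irrelevant_mul J (a * p - a@_0 *: p).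
Proof.
case: (idealJ) => _ _ JM _ pJ.
elim/mpolyind: a => [|c m a _ _ IHa].
  by rewrite mul0r mcoeff0 scale0r subr0; exact: irrelevant_mul0.
rewrite mcoeffD scalerDl mulrDl opprD addrACA.
apply: irrelevant_mulD => //; rewrite mcoeffZ mcoeffX -scalerAl -scalerA -scalerBr.
apply: irrelevant_mulZ.
have [->|nz_m] := eqVneq m 0%MM.
  by rewrite scale1r mpolyX0 mul1r subrr; exact: irrelevant_mul0.
rewrite scale0r subr0.
have /existsP[i mi] : [exists i, m i != 0%N].
  apply: contraNT nz_m; rewrite negb_exists => /forallP m0.
  by apply/eqP/mnmP => i; rewrite mnm0E; apply/eqP/negPn/m0.
have -> : m = (U_(i) + (m - U_(i)))%MM by rewrite addmC submK ?lep1mP.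
by rewrite mpolyXD -mulrA; apply: irrelevant_mulX; exact: JM.
Qed.

(** Multiplying by a variable shifts exponents: the coefficient of ['X_i * q]
    at [M] is the coefficient of [q] at [M - U_(i)], or 0 when ['X_i] does not
    divide ['X_[M]].  So a monomial none of whose quotients by a variable occurs
    in [J] witnesses indecomposability. *)
Lemma irrelevant_coeff0 (M : 'X_{1..N}) p :
    (forall i q, (0 < M i)%N -> q \in J -> q@_(M - U_(i)) = 0) ->
  irrelevant_mul J p -> p@_M = 0.
Proof.
move=> M0 [q qJ ->]; rewrite raddf_sum big1 // => i _ /=.
have [Mi0|Mi] := posnP (M i); last first.
  rewrite -[M in _@_M](submK (_ : U_(i) <= M)%MM) ?lep1mP -?lt0n //.
  by rewrite addmC mulrC mcoeffMX M0.
apply/eqP; rewrite mcoeff_eq0; apply/negP => /msuppM_le/allpairsP[[a b]] /= [].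
by rewrite msuppX inE => /eqP-> _ def_M; move: Mi0; rewrite def_M mnmDE mnm1E eqxx.
Qed.

End GradedNakayama.

Section IdealGen.
Variables (R : comNzRingType) (G : R -> Prop).

Lemma in_ideal_gen_id g : G g -> in_ideal_gen G g.
Proof.
by move=> Gg; exists [:: (1, g)]; rewrite big_seq1 mul1r; split=> // p /[!inE] /eqP->.
Qed.

Lemma in_ideal_gen0 : in_ideal_gen G 0.
Proof. by exists [::]; rewrite big_nil. Qed.

Lemma in_ideal_genD f g :
  in_ideal_gen G f -> in_ideal_gen G g -> in_ideal_gen G (f + g).
Proof.
move=> [s [sG ->]] [r [rG ->]]; exists (s ++ r); rewrite big_cat; split=> // p.
by rewrite mem_cat => /orP[/sG|/rG].
Qed.

Lemma in_ideal_genM a f : in_ideal_gen G f -> in_ideal_gen G (a * f).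
Proof.
move=> [s [sG ->]]; exists [seq (a * p.1, p.2) | p <- s]; split=> [p|].
  by case/mapP=> q /sG Gq ->.
by rewrite big_map mulr_sumr; apply: eq_bigr => p _; rewrite mulrA.
Qed.

End IdealGen.

Section MinimalGenerators.
Variables (N : nat) (k : fieldType) (J : {pred {mpoly k[N.+1]}}).
Hypothesis idealJ : homogeneous_ideal J.

Let component e (p : {mpoly k[N.+1]}) : dhomog N.+1 k e := DHomog (pihomogP mdeg e p).

(** [WX.1] is the degree [e] part of [S_+ J], and [WX.2] a basis of the degree
    [e] part of [J] modulo it.  The last clause lets the generating set made of
    these bases pass through a prescribed indecomposable [f]. *)
Definition adapted_basis (f : {mpoly k[N.+1]}) (e : nat)
    (WX : {vspace dhomog N.+1 k e} * seq (dhomog N.+1 k e)) : Prop :=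
  [/\ forall u, u \in WX.1 <-> irrelevant_mul J (val u),
      free (vbasis WX.1 ++ WX.2),
      forall u, u \in <<vbasis WX.1 ++ WX.2>>%VS <-> val u \in J
    & ~ irrelevant_mul J (pihomog mdeg e f) -> component e f \in WX.2].

Lemma exists_adapted_basis (f : {mpoly k[N.+1]}) (e : nat) :
  f \in J -> exists WX, @adapted_basis f e WX.
Proof.
move=> fJ; case: (idealJ) => J0 JD JM JH.
have JZ c p : p \in J -> c *: p \in J by rewrite -mul_mpolyC; exact: JM.
have [U UP] : exists U : {vspace dhomog N.+1 k e}, forall v, v \in U <-> val v \in J.
  by apply: submod_vspace => // a u v uJ vJ; apply: JD => //; exact: JZ.
have [W WP] : exists W : {vspace dhomog N.+1 k e},
    forall v, v \in W <-> irrelevant_mul J (val v).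
  apply: submod_vspace => [|a u v uJ vJ]; first exact: irrelevant_mul0.
  by apply: irrelevant_mulD => //; exact: irrelevant_mulZ.
have sWU : (W <= U)%VS.
  by apply/subvP=> v /WP /(irrelevant_mul_sub idealJ) /UP.
have fU : component e f \in U by apply/UP; exact: JH.
have [X [fX /andP[/eqP spanX freeX]]] := relative_basis sWU fU.
exists (W, X); split=> //= [u|nf]; first by rewrite spanX.
by apply: fX; apply/negP => /WP.
Qed.

(** The union [G] over all degrees of the bases of [J] modulo [S_+ J] generates
    [J], by induction on the degree.  It is minimal because, modulo [S_+ J], the
    degree [e] part of an ideal combination of elements of [G] is a linear
    combination of those of degree [e], which are independent.  The positive
    number of variables is what gives homogeneous polynomials their structure of
    finite dimensional space. *)
Lemma succ_minimal_generator d (f : {mpoly k[N.+1]}) :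
    f \in J -> f \is d.-homog -> ~ irrelevant_mul J f ->
  minimal_generator J f.
Proof.
move=> fJ fd nf; case: (idealJ) => J0 JD JM JH.
have [WX WXP] : exists WX :
    forall e, {vspace dhomog N.+1 k e} * seq (dhomog N.+1 k e),
    forall e, adapted_basis f (WX e).
  pose ex e := constructive_indefinite_description _ (exists_adapted_basis e fJ).
  by exists (fun e => proj1_sig (ex e)) => e; exact: (proj2_sig (ex e)).
pose G g := exists e, exists2 x, x \in (WX e).2 & g = val x.
have GJ g : G g -> g \in J.
  case=> e [x xX ->]; have [_ _ spanX _] := WXP e.
  by apply/spanX; apply: memv_span; rewrite mem_cat xX orbT.
suff minG : minimal_homog_generating_set J G.
  exists G => //.
  have [_ _ _] := WXP d; rewrite (pihomog_dE fd) => /(_ nf) fX.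
  by exists d, (component d f) => //=; rewrite pihomog_dE.
have Gsub (G' : {mpoly k[N.+1]} -> Prop) g :
    (forall g, G' g -> G g) -> in_ideal_gen G' g -> g \in J.
  move=> sG' [s [sG ->]]; rewrite big_seq.
  by elim/big_ind: _ => // p /sG/sG'/GJ; exact: JM.
split.
- by move=> g [e [x _ ->]]; apply/homogP; exists e; exact: dhomog_is_dhomog.
- move=> g; split; last exact: Gsub.
  have homog_gen e p : p \in J -> p \is e.-homog -> in_ideal_gen G p.
    elim/ltn_ind: e p => e IHe p pJ pe; have [WP _ spanX _] := WXP e.
    have /spanX : val (DHomog pe) \in J by [].
    rewrite span_cat (span_basis (vbasisP _)) => /memv_addP[w /WP wJ [x xX def_p]].
    have -> : p = val w + val x by rewrite -[p]/(val (DHomog pe)) def_p.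
    apply: in_ideal_genD; last first.
      rewrite (coord_span (X := in_tuple (WX e).2) xX) linear_sum /=.
      elim/big_ind: _ => [||i _].
      - exact: in_ideal_gen0.
      - exact: in_ideal_genD.
      rewrite -mul_mpolyC; apply/in_ideal_genM/in_ideal_gen_id.
      by exists e, (tnth (in_tuple (WX e).2) i); rewrite ?mem_tnth //= (tnth_nth 0).
    rewrite -(pihomog_dE (dhomog_is_dhomog w)).
    case: wJ => q qJ ->; rewrite linear_sum /=.
    elim/big_ind: _ => [||i _]; [exact: in_ideal_gen0 | exact: in_ideal_genD |].
    case: (e) IHe => [|e'] IHe; first by rewrite pihomog0XM; exact: in_ideal_gen0.
    rewrite pihomogXM; apply: in_ideal_genM.
    by apply: (IHe e') => //; [exact: JH | exact: pihomogP].
  move=> gJ; rewrite (pihomog_partitionE (leqnn (mmeasure mdeg g))).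
  elim/big_ind: _ => [||d' _]; [exact: in_ideal_gen0 | exact: in_ideal_genD |].
  by apply: (homog_gen d'); [exact: JH | exact: pihomogP].
move=> G' sG' genG' g Gg; have [e [x xX def_g]] := Gg.
apply: NNPP => nG'g; have [WP freeX _ _] := WXP e.
pose V := <<vbasis (WX e).1 ++ rem x (WX e).2>>%VS.
have WV w : w \in (WX e).1 -> w \in V.
  rewrite /V span_cat (span_basis (vbasisP _)); exact/subvP/addvSl.
have xV : x \notin V.
  have move_x : perm_eq (vbasis (WX e).1 ++ (WX e).2)
                        (x :: vbasis (WX e).1 ++ rem x (WX e).2).
    by rewrite perm_sym -cat1s perm_catCA perm_cat2l perm_sym perm_to_rem.
  by move: freeX; rewrite (perm_free move_x) free_cons => /andP[].
have [s [sgen def_s]] : in_ideal_gen G' g by apply/genG'; exact: GJ.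
case/negP: xV; have -> : x = component e g.
  by apply: val_inj; rewrite /= pihomog_dE def_g ?dhomog_is_dhomog.
have compD p q : component e (p + q) = component e p + component e q.
  by apply: val_inj; rewrite /= pihomogD.
have compZ c p : component e (c *: p) = c *: component e p.
  by apply: val_inj; rewrite /= linearZ.
have comp0 : component e 0 = 0 by apply: val_inj; rewrite /= pihomog0.
rewrite def_s big_seq; elim/big_ind: _ => [|p q pV qV|[a h] /sgen/= G'h].
- by rewrite comp0 mem0v.
- by rewrite compD memvD.
rewrite -[a * h](subrK (a@_0 *: h)) compD compZ memvD //.
  apply/WV/WP; rewrite /=.
  by apply: irrelevant_mul_pihomog => //; apply: mul_mod_irrelevant => //; exact/GJ/sG'.
have [e' [y yX def_h]] := sG' _ G'h; apply: memvZ.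
have [eq_e|ne_e] := eqVneq e' e; last first.
  suff -> : component e h = 0 by rewrite mem0v.
  apply: val_inj; rewrite /= (pihomog_ne0 ne_e) // def_h; exact: dhomog_is_dhomog.
subst e'; have -> : component e h = y.
  by apply: val_inj; rewrite /= def_h pihomog_dE ?dhomog_is_dhomog.
apply: memv_span; rewrite mem_cat; apply/orP; right.
rewrite mem_rem_uniq ?inE ?yX ?andbT; last first.
  by have := free_uniq freeX; rewrite cat_uniq => /and3P[].
by apply: contra_notN nG'g => /eqP eq_y; rewrite def_g -eq_y -def_h.
Qed.
End MinimalGenerators.

Lemma indecomposable_minimal_generator (N : nat) (k : fieldType)
    (J : {pred {mpoly k[N]}}) (d : nat) (f : {mpoly k[N]}) :
    (0 < N)%N -> homogeneous_ideal J ->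
    f \in J -> f \is d.-homog -> ~ irrelevant_mul J f ->
  minimal_generator J f.
Proof.
by case: N J f => [|N] J f // _ idealJ; exact: (succ_minimal_generator idealJ).
Qed.

(** * Terms of a product of two minors *)

Section Increasing.
Variables (t l : nat).
Implicit Types f g : {ffun 'I_t -> 'I_l}.

Lemma increasing_inj f : increasing f -> injective f.
Proof.
move=> /forallP incf i j eq_f; apply/val_inj/eqP.
have lt_f (a b : 'I_t) : (a < b)%N -> f a != f b.
  by have /forallP/(_ b)/implyP := incf a => /[apply] /ltn_eqF /negbT.
by case: ltngtP => // /lt_f; rewrite eq_f eqxx.
Qed.

Lemma increasing_eq f g :
  increasing f -> increasing g -> {subset codom f <= codom g} -> f = g.
Proof.
move=> incf incg sub_fg.
have sorted_val (h : {ffun 'I_t -> 'I_l}) :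
    increasing h -> sorted ltn (map val (codom h)).
  move=> /forallP inch; rewrite codomE -map_comp.
  rewrite sorted_map; have : sorted ltn (map val (enum 'I_t)).
    by rewrite val_enum_ord iota_ltn_sorted.
  rewrite sorted_map => enum_lt; apply: (sub_sorted _ enum_lt) => a b /= ab.
  by have /forallP/(_ b)/implyP/(_ ab) := inch a.
have codom_fg : codom f =i codom g.
  have uniq_f : uniq (codom f) by apply/injectiveP/increasing_inj.
  have le_size : (size (codom g) <= size (codom f))%N by rewrite !size_codom.
  exact: (uniq_min_size uniq_f sub_fg le_size).2.
have : map val (codom f) = map val (codom g).
  apply: (irr_sorted_eq ltn_trans ltnn); rewrite ?sorted_val // => x.
  exact: (eq_mem_map val codom_fg).
move/(inj_map val_inj); rewrite !codomE => /eq_in_map eq_fg.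
by apply/ffunP => i; apply: eq_fg; rewrite mem_enum.
Qed.

End Increasing.

Section Cells.
Variables (t m n : nat).
Implicit Types (r : 'I_t -> 'I_m) (c : 'I_t -> 'I_n).

(** A term of a minor, up to sign.  Read as an [m] by [n] matrix, this exponent
    is for injective [r] and [c] a partial permutation matrix with [t] entries 1. *)
Definition cells r c : 'X_{1..m * n} :=
  (\sum_(l < t) U_(mxvec_index (r l) (c l)))%MM.

Lemma cellsE r c i : cells r c i = (\sum_(l < t) (mxvec_index (r l) (c l) == i))%N.
Proof. by rewrite mnm_sumE; apply: eq_bigr => l _; rewrite mnm1E. Qed.

Lemma mdeg_cells r c : mdeg (cells r c) = t.
Proof.
rewrite mdeg_sum (eq_bigr (fun=> 1%N)) => [|l _]; last exact: mdeg1.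
by rewrite sum1_card card_ord.
Qed.

Lemma mxvec_index_inj (a a' : 'I_m) (b b' : 'I_n) :
  mxvec_index a b = mxvec_index a' b' -> a = a' /\ b = b'.
Proof.
have [g gK _] := curry_mxvec_bij m n.
by move=> eq_ab; have := congr1 g eq_ab; rewrite !(gK (_, _)) // => -[-> ->].
Qed.

Lemma cells_gt0P r c i :
  reflect (exists l, mxvec_index (r l) (c l) = i) (0 < cells r c i)%N.
Proof.
rewrite cellsE lt0n sum_nat_eq0 negb_forall.
apply: (iffP existsP) => -[l]; first by rewrite eqb0 negbK => /eqP; exists l.
by move/eqP=> eq_i; exists l; rewrite eq_i.
Qed.

Lemma cells_le1 r c i : injective r -> (cells r c i <= 1)%N.
Proof.
move=> inj_r; have [|/cells_gt0P[l def_i]] := posnP (cells r c i); first by move->.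
rewrite cellsE (bigD1 l) //= def_i eqxx big1 // => l' ne_l; apply/eqP.
rewrite eqb0 -def_i; apply: contra ne_l => /eqP/mxvec_index_inj[/inj_r-> _] //.
Qed.

Variables (r1 r2 : 'I_t -> 'I_m) (c1 c2 : 'I_t -> 'I_n) (k : 'I_t).

Hypothesis forced : forall l, [\/ r1 l = r2 k, c1 l = c2 k
  | exists l', r2 l' = r1 l /\ c2 l' = c1 l].

(** Write P, P', P1 and P2 for the four partial permutation matrices, so that
    P + P' = P1 + P2, and suppose that P' has the cell [k] of P2.  A cell of P1 in
    the row or column of that cell cannot be in P', so it is in P; a cell of both
    P1 and P2 has multiplicity 2 in the sum, so it is in P and in P'.  Hence P
    contains P1, and both have [t] cells. *)
Lemma cells_splitl r c r' c' :
    injective r -> injective r' -> injective c' ->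
    (cells r c + cells r' c' = cells r1 c1 + cells r2 c2)%MM ->
    (0 < cells r' c' (mxvec_index (r2 k) (c2 k)))%N -> injective r1 ->
  cells r c = cells r1 c1 /\ cells r' c' = cells r2 c2.
Proof.
move=> inj_r inj_r' inj_c' eq_sum /cells_gt0P[l2 /mxvec_index_inj[eq_r2 eq_c2]] inj_r1.
suff eq1 : cells r c = cells r1 c1.
  by split=> //; move: eq_sum; rewrite eq1 => /addmI.
have eq_at i : (cells r c i + cells r' c' i = cells r1 c1 i + cells r2 c2 i)%N.
  by have := congr1 (fun M : 'X_{1..m * n} => M i) eq_sum; rewrite !mnmDE.
have le1 : (cells r1 c1 <= cells r c)%MM.
  apply/mnm_lepP => i.
  have [->//|gt0] := posnP (cells r1 c1 i).
  apply: leq_trans (cells_le1 c1 i inj_r1) _; rewrite lt0n; apply/eqP => cells0.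
  have := eq_at i; rewrite cells0 add0n => eq_i.
  have cells2 : cells r2 c2 i = 0%N.
    by have := cells_le1 c' i inj_r'; lia.
  have /cells_gt0P[l1 def_i'] : (0 < cells r' c' i)%N by lia.
  have /cells_gt0P[l def_i] := gt0.
  have [eq_r1 eq_c1] := mxvec_index_inj (etrans def_i' (esym def_i)).
  have no2 l' : mxvec_index (r2 l') (c2 l') <> i.
    by move=> eq_l'; move: cells2; apply/eqP; rewrite -lt0n; apply/cells_gt0P; exists l'.
  have [eq_r|eq_c|[l' [eq_r eq_c]]] := forced l; last 1 first.
  - by apply: (no2 l'); rewrite eq_r eq_c.
  - have eq_l : l1 = l2 by apply: inj_r'; rewrite eq_r1 eq_r2.
    by apply: (no2 k); rewrite -eq_r2 -eq_c2 -eq_l.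
  - have eq_l : l1 = l2 by apply: inj_c'; rewrite eq_c1 eq_c2.
    by apply: (no2 k); rewrite -eq_r2 -eq_c2 -eq_l.
have : mdeg (cells r c - cells r1 c1)%MM == 0%N.
  have := congr1 mdeg (submK le1); rewrite mdegD !mdeg_cells; lia.
by rewrite mdeg_eq0 => /eqP eq0; rewrite -(submK le1) eq0 add0m.
Qed.

(** One of the two summands has to contain the cell [k] of [r2], [c2], which
    decides between the two orders. *)
Lemma cells_split r c r' c' :
    injective r -> injective c -> injective r' -> injective c' -> injective r1 ->
    (cells r c + cells r' c' = cells r1 c1 + cells r2 c2)%MM ->
  (cells r c = cells r1 c1 /\ cells r' c' = cells r2 c2) \/
  (cells r c = cells r2 c2 /\ cells r' c' = cells r1 c1).
Proof.
move=> inj_r inj_c inj_r' inj_c' inj_r1 eq_sum.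
have := congr1 (fun M : 'X_{1..m * n} => M (mxvec_index (r2 k) (c2 k))) eq_sum.
have : (0 < cells r2 c2 (mxvec_index (r2 k) (c2 k)))%N by apply/cells_gt0P; exists k.
rewrite !mnmDE => gt0 eq_at.
have [eq0|] := posnP (cells r' c' (mxvec_index (r2 k) (c2 k))); last first.
  by move=> gt0'; left; apply: cells_splitl.
right; apply/and_comm; apply: cells_splitl => //; last by lia.
by rewrite addmC.
Qed.

End Cells.

Lemma cells_inj (t m n : nat) (r r' : {ffun 'I_t -> 'I_m}) (c c' : {ffun 'I_t -> 'I_n})
    (s s' : 'S_t) :
    increasing r -> increasing r' -> increasing c -> increasing c' ->
    cells r (c \o s) = cells r' (c' \o s') ->
  [/\ r = r', c = c' & s = s'].
Proof.
move=> incr incr' incc incc' eq_cells.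
have match_ l : exists l', r l = r' l' /\ c (s l) = c' (s' l').
  have : (0 < cells r (c \o s) (mxvec_index (r l) (c (s l))))%N.
    by apply/cells_gt0P; exists l.
  by rewrite eq_cells => /cells_gt0P[l' /mxvec_index_inj[<- <-]]; exists l'.
have eq_r : r = r'.
  apply: increasing_eq => // _ /codomP[l ->]; have [l' [-> _]] := match_ l.
  exact: codom_f.
have eq_c : c = c'.
  apply: increasing_eq => // _ /codomP[l ->].
  have [l' [_]] := match_ (s^-1%g l); rewrite permKV => ->; exact: codom_f.
split=> //; apply/permP => l; have [l' []] := match_ l.
rewrite -eq_r -eq_c => /(increasing_inj incr) <- /(increasing_inj incc) //.
Qed.

Section Minors.
Variables (k : fieldType) (t m n : nat).
Implicit Types (y : minor_index t m n) (s : 'S_t).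

Definition minor_term y s : 'X_{1..m * n} := cells (val y.1) (val y.2 \o s).

Lemma generic_minorE y :
  generic_minor k y = \sum_(s : 'S_t) (-1) ^+ s *: 'X_[minor_term y s].
Proof.
apply: eq_bigr => s _; rewrite scaler_sign mulr_sign.
have -> : 'X_[minor_term y s] =
    \prod_i mxsub (val y.1) (val y.2) (generic_matrix k m n) i (s i) => //.
rewrite (big_morph (fun M => 'X_[M] : {mpoly k[m * n]}) (@mpolyXD _ _) (@mpolyX0 _ _)).
by apply: eq_bigr => i _; rewrite !mxE.
Qed.

Lemma generic_minor_homog y : generic_minor k y \is t.-homog.
Proof.
rewrite generic_minorE; apply: rpred_sum => s _; apply: rpredZ.
by rewrite dhomogX /= mdeg_cells.
Qed.

Lemma mcoeff_minorM y y' M :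
  (generic_minor k y * generic_minor k y')@_M =
  \sum_s \sum_s' (-1) ^+ (s : 'S_t) * (-1) ^+ (s' : 'S_t)
    * ((minor_term y s + minor_term y' s')%MM == M)%:R.
Proof.
rewrite !generic_minorE mulr_suml linear_sum; apply: eq_bigr => s _ /=.
rewrite mulr_sumr linear_sum; apply: eq_bigr => s' _ /=.
by rewrite -scalerAl -scalerAr scalerA -mpolyXD mcoeffZ mcoeffX.
Qed.

Lemma minor_termI y y' s s' :
  minor_term y s = minor_term y' s' -> y = y' /\ s = s'.
Proof.
move=> /(cells_inj (valP y.1) (valP y'.1) (valP y.2) (valP y'.2)).
by case: y y' => [r c] [r' c'] /= [/val_inj-> /val_inj-> ->].
Qed.

(** The hypothesis of [cells_split] for the terms of [y1] and [y2] given by the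
    permutations [s1] and [s2]; [l0] is the cell of [y2] that forces the rest. *)
Definition rigid (y1 y2 : minor_index t m n) (s1 s2 : 'S_t) : Prop :=
  exists l0, forall l, [\/ val y1.1 l = val y2.1 l0, val y1.2 (s1 l) = val y2.2 (s2 l0)
    | exists l', val y2.1 l' = val y1.1 l /\ val y2.2 (s2 l') = val y1.2 (s1 l)].

Variables (y1 y2 : minor_index t m n) (s1 s2 : 'S_t).
Hypothesis rigid12 : rigid y1 y2 s1 s2.
Let mu := (minor_term y1 s1 + minor_term y2 s2)%MM.

Lemma rigid_split y y' s s' : (minor_term y s + minor_term y' s' = mu)%MM ->
  ((y, s) = (y1, s1) /\ (y', s') = (y2, s2)) \/
  ((y, s) = (y2, s2) /\ (y', s') = (y1, s1)).
Proof.
have inj_col (z : minor_index t m n) (u : 'S_t) : injective (val z.2 \o u).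
  by apply: inj_comp; [exact: increasing_inj (valP z.2) | exact: perm_inj].
have inj_row (z : minor_index t m n) : injective (val z.1).
  exact: increasing_inj (valP z.1).
have [l0 forced] := rigid12.
move=> /(cells_split (k := l0) forced) [] //.
  by move=> [/minor_termI[-> ->] /minor_termI[-> ->]]; left.
by move=> [/minor_termI[-> ->] /minor_termI[-> ->]]; right.
Qed.

Lemma rigid_support y y' : (generic_minor k y * generic_minor k y')@_mu != 0 ->
  (y, y') = (y1, y2) \/ (y, y') = (y2, y1).
Proof.
rewrite mcoeff_minorM => nz.
have [s [s' /eqP eq_mu]] :
    exists s, exists s', (minor_term y s + minor_term y' s')%MM == mu.
  have [/existsP[s /existsP[s']]|/existsPn no] :=
    boolP [exists s, exists s', (minor_term y s + minor_term y' s')%MM == mu].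
    by exists s, s'.
  case/eqP: nz; rewrite big1 // => s _; rewrite big1 // => s' _.
  by have /existsPn/(_ s')/negPf-> := no s; rewrite mulr0.
by case: (rigid_split eq_mu) => -[[-> _] [-> _]]; [left|right].
Qed.

(** Only one pair of terms produces [mu], so the signs cannot cancel. *)
Lemma rigid_coeff : y1 != y2 -> (generic_minor k y1 * generic_minor k y2)@_mu != 0.
Proof.
move=> ne12; rewrite mcoeff_minorM (bigD1 s1) //= (bigD1 s2) //= eqxx mulr1.
rewrite big1 => [|s' ne_s']; last first.
  case: eqP => [/rigid_split|_]; last by rewrite mulr0.
  case=> [[_ [eq_s]]|[[eq_y _] _]]; first by rewrite eq_s eqxx in ne_s'.
  by rewrite eq_y eqxx in ne12.
rewrite addr0 big1 ?addr0 => [|s ne_s]; first by rewrite mulf_neq0 ?signr_eq0.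
rewrite big1 // => s' _; case: eqP => [/rigid_split|_]; last by rewrite mulr0.
case=> [[[eq_s] _]|[[eq_y _] _]]; first by rewrite eq_s eqxx in ne_s.
by rewrite eq_y eqxx in ne12.
Qed.

End Minors.

(** * Coefficients of relations *)

Section HomogComp.
Variables (R : fieldType) (N M t : nat) (lq : N.-tuple {mpoly R[M]}).
Hypothesis lq_homog : forall i, tnth lq i \is t.-homog.

Lemma comp_mpolyX_homog mu : ('X_[mu] \mPo lq) \is (t * mdeg mu).-homog.
Proof.
rewrite comp_mpolyX mdegE big_distrr /=.
elim/big_rec2: _ => [|i d p _ pd]; first exact: dhomog1.
by apply: dhomogM => //; exact: dhomogMn.
Qed.

(** Substituting forms of degree [t] multiplies degrees by [t], so that kernels of
    such substitutions are homogeneous. *)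
Lemma comp_mpoly_pihomog d p : (0 < t)%N ->
  pihomog mdeg d p \mPo lq = pihomog mdeg (t * d) (p \mPo lq).
Proof.
move=> t_gt0; elim/mpolyind: p => [|c mu p _ _ IHp].
  by rewrite pihomog0 comp_mpoly0 pihomog0.
rewrite pihomogD !comp_mpolyD pihomogD IHp; congr (_ + _).
rewrite !linearZ /= pihomogX; congr (_ *: _).
have [<-|ne_d] := eqVneq; first by rewrite pihomog_dE ?comp_mpolyX_homog.
rewrite comp_mpoly0 (pihomog_ne0 _ (comp_mpolyX_homog mu)) //.
by rewrite eqn_pmul2l.
Qed.
End HomogComp.

Section Relations.
Variables (k : fieldType) (t m n : nat).
Hypothesis t_gt0 : (0 < t)%N.
Local Notation J := (minor_relations k t m n).
Local Notation N := #|minor_index t m n|.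
Let minors := [tuple generic_minor k (enum_val i) | i < N].

Lemma minors_homog i : tnth minors i \is t.-homog.
Proof. by rewrite tnth_mktuple; exact: generic_minor_homog. Qed.

Lemma minor_relationsP p : reflect (p \mPo minors = 0) (p \in J).
Proof. exact: eqP. Qed.

Lemma minor_relations_ideal : homogeneous_ideal J.
Proof.
split=> [|p q /minor_relationsP p0 /minor_relationsP q0|a p|d p].
- by apply/minor_relationsP; exact: comp_mpoly0.
- by apply/minor_relationsP; rewrite comp_mpolyD p0 q0 addr0.
- by move/minor_relationsP=> p0; apply/minor_relationsP; rewrite rmorphM /= p0 mulr0.
move/minor_relationsP=> p0; apply/minor_relationsP.
by rewrite (comp_mpoly_pihomog minors_homog) // p0 pihomog0.
Qed.

Definition minor_var (y : minor_index t m n) : 'I_N := enum_rank y.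

Lemma comp_minor_var y : 'X_(minor_var y) \mPo minors = generic_minor k y.
Proof.
by rewrite comp_mpolyXU -tnth_nth tnth_mktuple /minor_var enum_rankK.
Qed.

Lemma mdeg_eq2 N' (M : 'X_{1..N'}) : mdeg M = 2 -> exists i j, M = (U_(i) + U_(j))%MM.
Proof.
move=> deg2.
have /existsP[i Mi] : [exists i, M i != 0%N].
  rewrite -negb_forall; apply/negP => /forallP M0.
  by move: deg2; rewrite mdegE big1 // => i _; apply/eqP/M0.
have def_M : (M - U_(i) + U_(i))%MM = M by rewrite submK // lep1mP.
have /eqP/mdeg1P[j /eqP def_j] : mdeg (M - U_(i))%MM = 1%N.
  by move: deg2; rewrite -{1}def_M mdegD mdeg1; lia.
by exists j, i; rewrite -{1}def_M def_j.
Qed.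

(** The substitution sends ['X_[M]] to a form of degree [t * mdeg M], and the
    monomial [mu] has degree [2 * t].  Hence only quadratic [M] can produce [mu],
    and among these only the pair [y1], [y2] does: its coefficient in [q] is, up
    to a nonzero factor, the coefficient of [mu] in the image 0 of [q]. *)
Lemma relation_coeff0 y1 y2 (s1 s2 : 'S_t) q :
    rigid y1 y2 s1 s2 -> y1 != y2 -> q \in J ->
  q@_(U_(minor_var y1) + U_(minor_var y2)) = 0.
Proof.
move=> rig ne12 /minor_relationsP q0.
set M0 := (U_(_) + _)%MM; set mu := (minor_term y1 s1 + minor_term y2 s2)%MM.
have X2 y y' : 'X_[U_(minor_var y) + U_(minor_var y')] \mPo minors =
    generic_minor k y * generic_minor k y'.
  by rewrite mpolyXD rmorphM /= !comp_minor_var.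
have mu_neq M : M != M0 -> ('X_[M] \mPo minors)@_mu = 0.
  move=> neM; apply/eqP; apply: contraNT neM => nz.
  have degM : mdeg M = 2.
    have : mdeg mu == (t * mdeg M)%N.
      apply: contraR nz => /(dhomog_nemf_coeff (comp_mpolyX_homog minors_homog M)) ->.
      by rewrite eqxx.
    by rewrite mdegD !mdeg_cells addnn -muln2 eqn_pmul2l // => /eqP.
  have [i [j def_M]] := mdeg_eq2 degM.
  move: nz; rewrite def_M -[i](enum_valK) -[j](enum_valK) -!/(minor_var _) X2.
  move=> /(rigid_support rig) [[-> ->]|[-> ->]] //.
  by rewrite addmC.
have := congr1 (mcoeff mu) q0; rewrite mcoeff0 comp_mpolyE raddf_sum /=.
under eq_bigr => M _ do rewrite mcoeffZ -comp_mpolyX.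
have [M0q|] := boolP (M0 \in msupp q); last by rewrite -mcoeff_eq0 => /eqP.
rewrite (bigD1_seq M0) ?msupp_uniq //= big1 => [|M /mu_neq->]; last by rewrite mulr0.
move/eqP; rewrite addr0 mulf_eq0 X2 (negbTE (rigid_coeff k rig ne12)) orbF.
by move/eqP.
Qed.

End Relations.

(** * The cubic relation *)

Section Cubic.
Variables (k : fieldType) (s m n : nat).
Local Notation t := s.+2.
Hypothesis le_tn : (t.+2 <= n)%N.

Lemma col_subproof (j : 'I_3) (l : 'I_t) :
  ((if l == 0%N :> nat then j : nat else l.+2) < n)%N.
Proof. by move: le_tn (ltn_ord j) (ltn_ord l); case: eqP; lia. Qed.

(** The common columns 3, ..., t + 1 come after the special one, at the positions
    [l > 0], where they do not depend on [j]. *)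
Definition cols_with (j : 'I_3) : {ffun 'I_t -> 'I_n} :=
  [ffun l => Ordinal (col_subproof j l)].

Lemma cols_with_increasing j : increasing (cols_with j).
Proof.
apply/forallP => a; apply/forallP => b; apply/implyP => ab; rewrite !ffunE /=.
by move: (ltn_ord j) ab; do 2!case: eqP; lia.
Qed.

Hypothesis le_tm : (t.+1 <= m)%N.

Definition rows_but (i : 'I_t.+1) : {ffun 'I_t -> 'I_m} :=
  [ffun l => widen_ord le_tm (lift i l)].

Lemma rows_but_increasing i : increasing (rows_but i).
Proof.
apply/forallP => a; apply/forallP => b; apply/implyP => ab.
by rewrite !ffunE /= ltn_neqAle leq_bump2 ltnW // eqn_leq !leq_bump2 -eqn_leq neq_ltn ab.
Qed.

Definition cubic_minor (i j : 'I_3) : minor_index t m n :=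
  (exist _ (rows_but (widen_ord (isT : (3 <= s.+3)%N) i)) (rows_but_increasing _),
   exist _ (cols_with j) (cols_with_increasing j)).

Lemma cubic_minor_inj i j i' j' :
  cubic_minor i j = cubic_minor i' j' -> i = i' /\ j = j'.
Proof.
move=> eq_y; split; apply/val_inj; last first.
  have /ffunP/(_ ord0) := congr1 (fun y : minor_index t m n => val y.2) eq_y.
  by rewrite !ffunE => /(congr1 val).
have /ffunP eq_r := congr1 (fun y : minor_index t m n => val y.1) eq_y.
have {eq_r} eq_l l : bump i l = bump i' l :> nat \/ (t <= l)%N.
  have [lt_l|] := ltnP l t; [left | by right].
  by have := eq_r (Ordinal lt_l); rewrite !ffunE => /(congr1 val).
have := eq_l 0%N; have := eq_l 1%N.
rewrite /bump /=; move: (ltn_ord i) (ltn_ord i'); lia.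
Qed.

Let p0 : 'I_t := ord0.
Let p1 : 'I_t := lift ord0 ord0.

(** Let [b] be the element of 0, 1, 2 other than [d] and [a].  In the term chosen
    for the minor without row [d], row [a] takes column 3 and row [b] takes column
    [j]; in the term chosen for the minor without row [a], row [b] takes column 3
    and row [d] takes column [j'].  Every row [l > 2] takes column [l + 1] in both.
    The cell in row [b] and column 3 conflicts with both special cells of the first
    term, which makes the pair rigid.  As rows are listed in increasing order,
    the permutation of the first term is a transposition when [a < b], that of the
    second one when [b < d]. *)
Lemma cubic_minor_rigid (d a j j' : 'I_3) : (d < a)%N ->
  exists s1 s2, rigid (cubic_minor d j) (cubic_minor a j') s1 s2.
Proof.
have rows_beyond (i i' : 'I_3) (l : 'I_t) : (2 <= l)%N ->
    val (cubic_minor i j).1 l = val (cubic_minor i' j').1 l.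
  move=> l2; apply/val_inj; rewrite /= !ffunE /= /bump.
  by move: (ltn_ord i) (ltn_ord i'); lia.
have cols_beyond (l : 'I_t) : (0 < l)%N ->
    val (cubic_minor d j).2 l = val (cubic_minor a j').2 l.
  by move=> l0; apply/val_inj; rewrite /= !ffunE /=; case: eqP => // l00; lia.
have split_l (l : 'I_t) : [\/ l = p0, l = p1 | (2 <= l)%N].
  case: l => [[|[|l]] ltl]; [constructor 1 | constructor 2 | constructor 3] => //.
  - exact: val_inj.
  - exact: val_inj.
have fixl (l : 'I_t) : (2 <= l)%N -> tperm p0 p1 l = l.
  by move=> l2; rewrite tpermD //; apply/eqP => eq_l; rewrite -eq_l in l2.
have row_eq (i i' : 'I_3) (l l' : 'I_t) : bump i l = bump i' l' ->
    val (cubic_minor i j).1 l = val (cubic_minor i' j').1 l'.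
  by move=> eq_l; apply/val_inj; rewrite /= !ffunE.
move=> lt_da.
have [[d0 a1]|[d0 a2]|[d1 a2]] : [\/ (d = 0 :> nat /\ a = 1 :> nat)%N,
   (d = 0 :> nat /\ a = 2 :> nat)%N | (d = 1 :> nat /\ a = 2 :> nat)%N].
- move: lt_da (ltn_ord a).
  case: (nat_of_ord d) => [|[|?]]; case: (nat_of_ord a) => [|[|[|?]]] //= _ _.
  + by constructor 1.
  + by constructor 2.
  + by constructor 3.
- exists (tperm p0 p1), 1%g, p1 => l; rewrite !perm1.
  have [->|->|l2] := split_l l.
  + by constructor 2; rewrite tpermL cols_beyond.
  + by constructor 1; apply: row_eq; rewrite d0 a1.
  constructor 3; exists l; rewrite perm1 fixl //.
  by split; [symmetry; exact: rows_beyond | rewrite cols_beyond // ltnW].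
- exists 1%g, 1%g, p1 => l; rewrite !perm1.
  have [->|->|l2] := split_l l.
  + by constructor 1; apply: row_eq; rewrite d0 a2.
  + by constructor 2; rewrite cols_beyond.
  constructor 3; exists l; rewrite perm1 //.
  by split; [symmetry; exact: rows_beyond | rewrite cols_beyond // ltnW].
exists 1%g, (tperm p0 p1), p0 => l; rewrite !perm1.
have [->|->|l2] := split_l l.
- by constructor 1; apply: row_eq; rewrite d1 a2.
- by constructor 2; rewrite tpermL cols_beyond.
constructor 3; exists l; rewrite fixl //.
by split; [symmetry; exact: rows_beyond | rewrite cols_beyond // ltnW].
Qed.

Definition cubic_relation : {mpoly k[#|minor_index t m n|]} :=
  \det (\matrix_(i < 3, j < 3) 'X_(minor_var (cubic_minor i j))).

Definition cubic_monomial (u : 'S_3) : 'X_{1..#|minor_index t m n|} :=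
  (\sum_(i < 3) U_(minor_var (cubic_minor i (u i))))%MM.

Lemma cubic_relationE :
  cubic_relation = \sum_(u : 'S_3) (-1) ^+ u *: 'X_[cubic_monomial u].
Proof.
apply: eq_bigr => u _; rewrite scaler_sign mulr_sign.
rewrite (big_morph (fun M => 'X_[M] : {mpoly k[_]}) (@mpolyXD _ _) (@mpolyX0 _ _)).
by have -> : \prod_i (\matrix_(i < 3, j < 3) 'X_(minor_var (cubic_minor i j))) i (u i)
   = \prod_(i < 3) 'X_[U_(minor_var (cubic_minor i (u i)))] :> {mpoly k[_]}
  by apply: eq_bigr => i _; rewrite mxE.
Qed.

Lemma cubic_relation_homog : cubic_relation \is 3.-homog.
Proof.
rewrite cubic_relationE; apply: rpred_sum => u _; apply: rpredZ.
rewrite dhomogX /= mdeg_sum (eq_bigr (fun=> 1%N)) => [|i _]; last exact: mdeg1.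
by rewrite sum1_card card_ord.
Qed.

Lemma minor_var_eq y y' :
  (minor_var y == minor_var y' :> 'I_#|minor_index t m n|) = (y == y').
Proof. exact: (inj_eq enum_rank_inj). Qed.

Lemma cubic_relation_coeff : cubic_relation@_(cubic_monomial 1%g) = 1.
Proof.
rewrite cubic_relationE raddf_sum (bigD1 1%g) //= mcoeffZ mcoeffX eqxx odd_perm1.
rewrite !mul1r big1 ?addr0 // => u ne_u; rewrite mcoeffZ mcoeffX.
case: eqP => [eq_u|_]; last by rewrite mulr0.
case/eqP: ne_u; apply/permP => i; rewrite perm1.
have /(congr1 (fun M : 'X_{1.._} => M (minor_var (cubic_minor i (u i))))) := eq_u.
rewrite !mnm_sumE (bigD1 i) //= mnm1E eqxx => eq_at.
have : (\sum_(l < 3) U_(minor_var (cubic_minor l ((1%g : 'S_3) l)))%MM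
   (minor_var (cubic_minor i (u i))) != 0)%N by rewrite -eq_at.
rewrite sum_nat_eq0 negb_forall => /existsP[l]; rewrite mnm1E eqb0 negbK.
by rewrite minor_var_eq perm1 => /eqP/cubic_minor_inj[-> <-].
Qed.

(** Removing a variable from y_00 y_11 y_22 leaves a product of two diagonal
    variables, which occurs in no relation by rigidity. *)
Lemma cubic_relation_indecomposable :
  ~ irrelevant_mul (minor_relations k t m n) cubic_relation.
Proof.
move=> /(irrelevant_coeff0 (M := cubic_monomial 1%g)).
rewrite cubic_relation_coeff => /(_ _)/eqP; rewrite oner_eq0 => H.
suff: false by []. apply: H => v q v_gt0 qJ.
have pair0 (a b : 'I_3) : a != b ->
    q@_(U_(minor_var (cubic_minor a a)) + U_(minor_var (cubic_minor b b))) = 0.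
  wlog lt_ab : a b / (a < b)%N => [wlog_ab ne_ab|ne_ab].
    case: (ltngtP a b) => [lt|lt|/val_inj eq_ab].
    - exact: wlog_ab.
    - by rewrite addmC; apply: wlog_ab => //; rewrite eq_sym.
    - by rewrite eq_ab eqxx in ne_ab.
  have [s1 [s2 rig]] := cubic_minor_rigid a b lt_ab.
  apply: (relation_coeff0 _ rig) => //.
  by apply: contra ne_ab => /eqP/cubic_minor_inj[->].
have def_M : cubic_monomial 1%g = (U_(minor_var (cubic_minor ord0 ord0)) +
   (U_(minor_var (cubic_minor (inord 1) (inord 1))) +
    U_(minor_var (cubic_minor ord_max ord_max))))%MM.
  rewrite /cubic_monomial !big_ord_recl big_ord0 !perm1 addm0.
  by do !congr (_ + _)%MM; congr (U_(minor_var (cubic_minor _ _)))%MM;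
    apply/val_inj; rewrite /= ?inordK.
have ne01 : ord0 != inord 1 :> 'I_3 by rewrite -val_eqE /= inordK.
have ne02 : ord0 != ord_max :> 'I_3 by [].
have ne12 : inord 1 != ord_max :> 'I_3 by rewrite -val_eqE /= inordK.
move: v_gt0; rewrite def_M !mnmDE !mnm1E.
set v0 := minor_var _; set v1 := minor_var _; set v2 := minor_var _.
have [<-|_] := eqVneq v0 v; first by rewrite addmC addmK pair0.
have [<-|_] := eqVneq v1 v; first by rewrite addmC -addmA addmC addmK pair0 1?eq_sym.
have [<-|//] := eqVneq v2 v.
by rewrite addmA addmK pair0.
Qed.

End Cubic.

(** * Vanishing of the determinant *)

Section Member.
Variables (k : fieldType) (s m n : nat).
Local Notation t := s.+2.
Hypotheses (le_tn : (t.+2 <= n)%N) (le_tm : (t.+1 <= m)%N).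
Local Notation R := {mpoly k[m * n]}.
Local Notation X := (generic_matrix k m n).
Local Notation col := (cols_with le_tn).

Let row (i : 'I_(3 + s)) : 'I_m := widen_ord le_tm i.

Let cofactor_minor (i : 'I_(3 + s)) (j : 'I_3) : R :=
  \det (\matrix_(a < t, b < t) X (rows_but le_tm i a) (col j b)).

Lemma cofactor_minorE (i j : 'I_3) :
  cofactor_minor (lshift s i) j = generic_minor k (cubic_minor le_tn le_tm i j).
Proof.
by congr (\det _); apply/matrixP => a b; rewrite !mxE.
Qed.

(** Laplace expansion along the first column of the square matrix obtained by
    putting a copy of a common column in front of the columns of the minor. *)
Lemma common_column_orthogonal (j : 'I_3) (e : 'I_s.+1) :
  \sum_(i < 3 + s) X (row i) (col j (lift ord0 e)) * ((-1) ^+ i * cofactor_minor i j) = 0.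
Proof.
pose Z : 'M[R]_(1 + t) := \matrix_(i, b)
  if unlift ord0 b is Some b' then X (row i) (col j b')
  else X (row i) (col j (lift ord0 e)).
have detZ : \det Z = 0.
  rewrite -det_tr; apply: (determinant_alternate (neq_lift ord0 (lift ord0 e))) => i.
  by rewrite [LHS]mxE [RHS]mxE [LHS]mxE [RHS]mxE unlift_none liftK.
apply: etrans detZ; rewrite (expand_det_col _ ord0); apply: eq_bigr => i _.
rewrite [in RHS]mxE unlift_none; congr (_ * _).
rewrite /cofactor addn0; congr (_ * \det _).
apply/matrixP => a b; rewrite [LHS]mxE [RHS]mxE [RHS]mxE [RHS]mxE liftK.
by congr (X _ _); rewrite ffunE.
Qed.

(* On the common columns the rows 2, ..., t form a square block of
   indeterminates, which shows that the common columns are independent. *)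
Let shifted_row (l : 'I_s.+1) : 'I_(3 + s) := rshift 2 l.

Let common_block : 'M[R]_s.+1 :=
  \matrix_(e, l) X (row (shifted_row l)) (col ord0 (lift ord0 e)).

(** Specializing the indeterminates just above the diagonal to 1 and the others
    to 0 turns the block into the identity. *)
Lemma common_block_det : \det common_block != 0.
Proof.
pose V : 'M[k]_(m, n) := \matrix_(a, b) (a.+1 == b :> nat)%:R.
apply/eqP => /(congr1 (meval (fun i => mxvec V ord0 i))); rewrite rmorph0 -det_map_mx.
suff -> : map_mx (meval (fun i => mxvec V ord0 i)) common_block = 1%:M.
  by rewrite det1 => /eqP; rewrite oner_eq0.
apply/matrixP => e l; rewrite !mxE mevalXU mxvecE mxE ffunE /=.
by rewrite /bump /= -val_eqE /= eq_sym.
Qed.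

(** There are [s + 1] common columns and only [s] rows beyond the first three, so
    some combination of the common columns vanishes on these rows.  The matrix
    [B] is padded with a zero column to be square. *)
Lemma common_vector : exists2 u : 'rV[R]_s.+1, u != 0 &
  forall i : 'I_s, \sum_e u ord0 e * X (row (rshift 3 i)) (col ord0 (lift ord0 e)) = 0.
Proof.
pose B : 'M[R]_s.+1 := \matrix_(e, l)
  if unlift ord0 l is Some i then X (row (rshift 3 i)) (col ord0 (lift ord0 e)) else 0.
have /det0P[u nz_u uB] : \det B == 0.
  rewrite (expand_det_col _ ord0) big1 // => e _.
  by rewrite mxE unlift_none mul0r.
exists u => // i; have /matrixP/(_ ord0 (lift ord0 i)) := uB.
rewrite mxE [RHS]mxE => uBi; apply: etrans uBi; apply: eq_bigr => e _.
by rewrite [B _ _]mxE liftK.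
Qed.

(** The combination of common columns that vanishes beyond the first three rows
    is orthogonal to the signed minors, hence gives a linear dependency between
    the three rows of [y_ij].  It is nontrivial since the common columns are
    independent. *)
Lemma cubic_relation_in : cubic_relation k le_tn le_tm \in minor_relations k t m n.
Proof.
apply/minor_relationsP; rewrite /cubic_relation -det_map_mx.
have [u nz_u u0] := common_vector.
pose w (i : 'I_(3 + s)) := \sum_e u ord0 e * X (row i) (col ord0 (lift ord0 e)).
have col_common j e : col j (lift ord0 e) = col ord0 (lift ord0 e).
  by apply/val_inj; rewrite !ffunE.
have w_orth j : \sum_(i < 3 + s) w i * ((-1) ^+ i * cofactor_minor i j) = 0.
  under eq_bigr => i _ do rewrite mulr_suml.
  rewrite exchange_big big1 // => e _ /=.
  under eq_bigr => i _ do rewrite -mulrA.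
  rewrite -mulr_sumr; under eq_bigr => i _ do rewrite -(col_common j).
  by rewrite common_column_orthogonal mulr0.
apply/eqP/det0P; exists (\row_(i < 3) (w (lshift s i) * (-1) ^+ i)).
  apply/eqP => w0.
  have w_lshift i : w (lshift s i) = 0.
    have /matrixP/(_ ord0 i) := w0; rewrite !mxE => /eqP.
    by rewrite mulf_eq0 signr_eq0 orbF => /eqP.
  have w_all i : w i = 0.
    by rewrite -(splitK i); case: (split i) => i' /=; [exact: w_lshift | exact: u0].
  case/negP: common_block_det; apply/det0P; exists u => //.
  apply/rowP => l; rewrite !mxE -[RHS](w_all (shifted_row l)).
  by apply: eq_bigr => e _; rewrite mxE.
apply/rowP => j; rewrite !mxE -[RHS](w_orth j) big_split_ord /=.
rewrite [X in _ + X]big1 ?addr0 => [|i _]; last by rewrite /w u0 mul0r.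
apply: eq_bigr => i _; rewrite !mxE -mulrA cofactor_minorE.
by rewrite comp_minor_var.
Qed.
End Member.

Theorem corollary3p1p8 (k : fieldType) (t m n : nat) :
  [pchar k] =i pred0 ->
  (m <= n)%N -> (1 < t)%N -> (t < m)%N -> (t + 1 < n)%N ->
  exists f : {mpoly k[#|minor_index t m n|]},
    f \is 3.-homog /\ minimal_generator (minor_relations k t m n) f.
Proof.
case: t => [|[|s]] // _ _ _ le_tm; rewrite addn1 => le_tn.
exists (cubic_relation k le_tn le_tm); split; first exact: cubic_relation_homog.
apply: (indecomposable_minimal_generator (d := 3)).
- exact: leq_ltn_trans (ltn_ord (minor_var (cubic_minor le_tn le_tm ord0 ord0))).
- exact: minor_relations_ideal.
- exact: cubic_relation_in.
- exact: cubic_relation_homog.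
exact: cubic_relation_indecomposable.
Qed.
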